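(* Let $\mathcal V$ be a Euclidean Jordan algebra, let $a\in\mathcal V$ and let $\mathcal E\subset\mathcal V$ be weakly spectral. Let $F:\mathcal V\to\mathbb R$ be a spectral function that is either a strictly convex function or a strictly convex norm in $\mathcal V$. Suppose that $\bar{x}$ is a local minimizer or a local maximizer of the map $$x \in \mathcal E \mapsto F(x-a).$$ Then $\bar{x}$ and $a$ operator commute.
   Context: A Euclidean Jordan algebra is a finite dimensional real inner product space $(\mathcal V,\langle\cdot,\cdot\rangle)$ with a bilinear product $\circ:\mathcal V\times\mathcal V\to\mathcal V$ that is commutative, satisfies the Jordan identity $x^2\circ(x\circ y)=x\circ(x^2\circ y)$ (with $x^2=x\circ x$), satisfies $\langle x\circ y,z\rangle=\langle y,x\circ z\rangle$ for all $x,y,z$, and (standing assumption) has a unit element $e$. Spectral decomposition: with $n$ the rank of $\mathcal V$, every $x\in\mathcal V$ can be written $x=\sum_{i=1}^n\lambda_i(x)e_i$ with $\{e_1,\dots,e_n\}$ a Jordan frame (pairwise orthogonal primitive idempotents summing to $e$) and $\lambda_1(x)\ge\cdots\ge\lambda_n(x)$ the uniquely determined eigenvalues of $x$; $\lambda(x)=(\lambda_1(x),\dots,\lambda_n(x))\in\mathbb R^n$. For $a\in\mathcal V$, $L_a:\mathcal V\to\mathcal V$ is $L_ax=a\circ x$. Elements $a,b\in\mathcal V$ operator commute if $L_aL_b=L_bL_a$. $\operatorname{Aut}(\mathcal V)$ is the set of invertible linear maps $X:\mathcal V\to\mathcal V$ with $X(a\circ b)=Xa\circ Xb$ for all $a,b\in\mathcal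 V$. A set $\mathcal E\subseteq\mathcal V$ is weakly spectral if $x\in\mathcal E$ implies $Xx\in\mathcal E$ for all $X\in\operatorname{Aut}(\mathcal V)$. $F:\mathcal V\to\mathbb R$ is a spectral function if $F(x)=f(\lambda(x))$ for all $x$, for some symmetric $f:\mathbb R^n\to\mathbb R$ (i.e. $f(Pu)=f(u)$ for all $n\times n$ permutation matrices $P$). $F$ is a strictly convex norm in $\mathcal V$ if it is a norm in $\mathcal V$ and $F(x+y)<2$ for any distinct nonzero $x,y\in\mathcal V$ with $F(x)=F(y)=1$. ''Strictly convex function'' has the usual meaning. $\bar x$ is a local minimizer (maximizer) of a map on $\mathcal E$ if $\bar x\in\mathcal E$ and the value at $\bar x$ is $\le$ ($\ge$) the value at all $x\in\mathcal E$ in some neighborhood of $\bar x$. *)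

(* Defs.v *)
From mathcomp Require Import all_boot all_order all_fingroup all_algebra.
From mathcomp Require Import boolp classical_sets reals.

Set Implicit Arguments.
Unset Strict Implicit.
Unset Printing Implicit Defensive.

Import Order.TTheory GRing.Theory Num.Theory.
Local Open Scope ring_scope.
Local Open Scope classical_set_scope.

(* Euclidean Jordan algebra structures on the finite dimensional real vector
   space [V]; [{dot V for idfun}] is the library's type of symmetric positive
   definite bilinear forms. *)
Record euclideanJordanAlgebra (R : realType) (V : vectType R) := EJA {
  jmul : {bilinear V -> V -> V};
  jinner : {dot V for idfun};
  junit : V;
  jmulC : forall x y, jmul x y = jmul y x;
  jmul_jordan : forall x y,
    jmul (jmul x x) (jmul x y) = jmul x (jmul (jmul x x) y);
  jinner_assoc : forall x y z, jinner (jmul x y) z = jinner y (jmul x z);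
  jmul1x : forall x, jmul junit x = x
}.

Section EuclideanJordanAlgebra.
Variables (R : realType) (V : vectType R) (J : euclideanJordanAlgebra V).

Local Notation "x ** y" := (jmul J x y) (at level 40, left associativity).

Definition jnorm (x : V) : R := Num.sqrt (jinner J x x).

(* [:: e; x; x^2; ...; x^k] *)
Definition jpowers (x : V) (k : nat) : seq V :=
  mkseq (fun i => iter i (jmul J x) (junit J)) k.+1.

Lemma jpowers_dependent (x : V) : ~~ free (jpowers x (dim V)).
Proof.
apply/negP; rewrite /free size_mkseq => /eqP eq_dim.
by have := dimvS (subvf <<jpowers x (dim V)>>%VS); rewrite eq_dim dimvf ltnn.
Qed.

Lemma ex_jpowers_dependent (x : V) : exists k, ~~ free (jpowers x k).
Proof. by exists (dim V); exact: jpowers_dependent. Qed.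

(* The degree of the minimal polynomial of [x]. *)
Definition jdegree (x : V) : nat := ex_minn (ex_jpowers_dependent x).

Lemma jdegree_le_dim (x : V) : (jdegree x <= dim V)%N.
Proof.
by rewrite /jdegree; case: ex_minnP => m _; apply; exact: jpowers_dependent.
Qed.

Definition is_jdegree (k : nat) : bool := `[< exists x, jdegree x = k >].

Lemma ex_is_jdegree : exists k, is_jdegree k.
Proof. by exists (jdegree 0); apply/asboolP; exists 0. Qed.

Lemma is_jdegree_le_dim (k : nat) : is_jdegree k -> (k <= dim V)%N.
Proof. by move=> /asboolP[x <-]; exact: jdegree_le_dim. Qed.

(* The rank: the largest degree of an element. *)
Definition jrank : nat := ex_maxn ex_is_jdegree is_jdegree_le_dim.

Definition jidempotent (c : V) : Prop := c ** c = c.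

Definition jprimitive (c : V) : Prop :=
  [/\ jidempotent c, c != 0 &
      ~ exists c1 c2 : V, [/\ jidempotent c1, jidempotent c2,
                              c1 != 0, c2 != 0 & c = c1 + c2]].

(* Idempotents are orthogonal when their Jordan product is 0; by
   [jinner_assoc] they are then also orthogonal for the inner product. *)
Definition jordan_frame (n : nat) (c : 'I_n -> V) : Prop :=
  [/\ forall i, jprimitive (c i),
      forall i j, i != j -> c i ** c j = 0 &
      \sum_i c i = junit J].

Definition is_eigenvalues (x : V) (l : 'cV[R]_jrank) : Prop :=
  (forall i j : 'I_jrank, (i <= j)%N -> l j 0 <= l i 0) /\
  exists2 c : 'I_jrank -> V, jordan_frame c & x = \sum_i l i 0 *: c i.

(* The spectral decomposition theorem says that [is_eigenvalues x] holds of
   exactly one vector, so the default value 0 is never used. *)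
Definition eigenvalues (x : V) : 'cV[R]_jrank :=
  xget 0 [set l | is_eigenvalues x l].

Definition Lop (a : V) : 'End(V) := linfun (jmul J a).

Definition operator_commute (a b : V) : Prop :=
  (Lop a \o Lop b)%VF = (Lop b \o Lop a)%VF.

Definition jaut : set 'End(V) :=
  [set X | bijective X /\ forall a b, X (a ** b) = X a ** X b].

Definition weakly_spectral (E : set V) : Prop :=
  forall x, E x -> forall X, jaut X -> E (X x).

Definition symmetric_function (n : nat) (f : 'cV[R]_n -> R) : Prop :=
  forall (s : 'S_n) (u : 'cV[R]_n), f (perm_mx s *m u) = f u.

Definition spectral_function (F : V -> R) : Prop :=
  exists2 f : 'cV[R]_jrank -> R,
    symmetric_function f & forall x, F x = f (eigenvalues x).

Definition strictly_convex_function (F : V -> R) : Prop :=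
  forall (x y : V) (t : R), x != y -> 0 < t -> t < 1 ->
    F (t *: x + (1 - t) *: y) < t * F x + (1 - t) * F y.

Definition is_norm (F : V -> R) : Prop :=
  [/\ forall x, 0 <= F x,
      forall x, F x = 0 -> x = 0,
      forall (t : R) (x : V), F (t *: x) = `|t| * F x &
      forall x y, F (x + y) <= F x + F y].

Definition strictly_convex_norm (F : V -> R) : Prop :=
  is_norm F /\
  forall x y : V, x != 0 -> y != 0 -> x != y -> F x = 1 -> F y = 1 ->
    F (x + y) < 2.

Definition local_minimizer (E : set V) (G : V -> R) (xbar : V) : Prop :=
  E xbar /\ exists2 r : R, 0 < r &
    forall x, E x -> jnorm (x - xbar) < r -> G xbar <= G x.

Definition local_maximizer (E : set V) (G : V -> R) (xbar : V) : Prop :=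
  E xbar /\ exists2 r : R, 0 < r &
    forall x, E x -> jnorm (x - xbar) < r -> G x <= G xbar.

End EuclideanJordanAlgebra.

(* Main.v *)
(** Put [z = xbar - a]. Automorphisms permute the Jordan frames, so [F] is
    invariant under them. Write [xbar] as a combination of the spectral
    idempotents [c_k]; let [V_k] be the Peirce space [V_{1/2}(c_k)] and [P_k]
    the Peirce reflection, an automorphism with eigenspace [V_k] for [-1].

    Every [h] in [V_k] is tangent at [xbar] to its automorphism orbit: for
    [w0 = 2 c_k - e] and [u] in [V_k], the square of [w0 + t u] is
    [e + t^2 u^2], so its spectral sign [w] is a square root of [e] at distance
    [O(t^2)], and the automorphism [2 L_w^2 - 1] moves [xbar] by
    [2 t u (w0 xbar) + O(t^2)]; every [h] in [V_k] has the form
    [2 u (w0 xbar)]. Convexity of [F] turns local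
    minimality, and equally local maximality, along these curves into
    [F z <= F (z + h)] for all [h] in [V_k]. Choose [h] with
    [z + h = (z + P_k z) / 2]: as [F (P_k z) = F z], strict convexity forces
    [P_k z = z]. Then [L_z] commutes with all [L_{c_k}], hence with
    [L_xbar]. *)
Require Import Defs.
From mathcomp Require Import all_boot all_order all_fingroup all_algebra.
From mathcomp Require Import boolp classical_sets reals.
From mathcomp Require Import lra.

Set Implicit Arguments.
Unset Strict Implicit.
Unset Printing Implicit Defensive.

Import Order.TTheory GRing.Theory Num.Theory.
Local Open Scope ring_scope.

(** * Jordan identities and Peirce reflections *)

Section JordanIdentities.
Variables (R : realType) (V : vectType R) (J : euclideanJordanAlgebra V).

Local Notation "x ** y" := (jmul J x y) (at level 40, left associativity).
Local Notation "''[' u , v ]" := (jinner J u v) : ring_scope.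

Lemma jmul0r x : x ** 0 = 0. Proof. exact: linear0r. Qed.
Lemma jmulDl x y z : (x + y) ** z = x ** z + y ** z.
Proof. exact: linearDl. Qed.
Lemma jmulDr x y z : x ** (y + z) = x ** y + x ** z.
Proof. exact: linearDr. Qed.
Lemma jmulNl x y : (- x) ** y = - (x ** y).
Proof. exact: linearNl. Qed.
Lemma jmulNr x y : x ** (- y) = - (x ** y).
Proof. exact: linearNr. Qed.
Lemma jmulZl k x y : (k *: x) ** y = k *: (x ** y).
Proof. exact: linearZl_LR. Qed.
Lemma jmulZr k x y : x ** (k *: y) = k *: (x ** y).
Proof. exact: linearZr_LR. Qed.
Lemma jmul_suml (I : Type) r (P : pred I) F y :
  (\sum_(i <- r | P i) F i) ** y = \sum_(i <- r | P i) (F i ** y).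
Proof. exact: linear_sumlz. Qed.
Lemma jmul_sumr (I : Type) r (P : pred I) x F :
  x ** (\sum_(i <- r | P i) F i) = \sum_(i <- r | P i) (x ** F i).
Proof. exact: linear_sumr. Qed.

Definition jmulE := (jmulDl, jmulDr, jmulNl, jmulNr, jmulZl, jmulZr).

Lemma jinnerC x y : '[x, y] = '[y, x].
Proof. by rewrite hermC expr0 mul1r. Qed.
Lemma jinner0l y : '[0, y] = 0. Proof. exact: linear0l. Qed.
Lemma jinnerDl x y z : '[x + y, z] = '[x, z] + '[y, z].
Proof. exact: linearDl. Qed.
Lemma jinnerDr x y z : '[x, y + z] = '[x, y] + '[x, z].
Proof. exact: linearDr. Qed.
Lemma jinnerNl x y : '[- x, y] = - '[x, y].
Proof. exact: linearNl. Qed.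
Lemma jinnerNr x y : '[x, - y] = - '[x, y].
Proof. exact: linearNr. Qed.
Lemma jinnerZl k x y : '[k *: x, y] = k * '[x, y].
Proof. exact: linearZl_LR. Qed.
Lemma jinnerZr k x y : '[x, k *: y] = k * '[x, y].
Proof. by rewrite jinnerC jinnerZl jinnerC. Qed.
Lemma jinner_suml (I : Type) r (P : pred I) F y :
  '[\sum_(i <- r | P i) F i, y] = \sum_(i <- r | P i) '[F i, y].
Proof. exact: linear_sumlz. Qed.

Definition jinnerE :=
  (jinnerDl, jinnerDr, jinnerNl, jinnerNr, jinnerZl, jinnerZr).

Lemma jinner_gt0 x : x != 0 -> 0 < '[x, x].
Proof. exact: neq0_dnorm_gt0. Qed.
Lemma jinner_ge0 x : 0 <= '[x, x].
Proof.
by have [->|/jinner_gt0/ltW//] := eqVneq x 0; rewrite jinner0l.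
Qed.
Lemma jinner_eq0 x : ('[x, x] == 0) = (x == 0).
Proof.
have [->|/jinner_gt0/gt_eqF//] := eqVneq x 0.
by rewrite jinner0l eqxx.
Qed.

Lemma jinner_inj x y : (forall w, '[x, w] = '[y, w]) -> x = y.
Proof.
move=> xy; apply/eqP; rewrite -subr_eq0 -jinner_eq0 {1}jinnerDl jinnerNl.
by rewrite xy subrr.
Qed.

End JordanIdentities.

(* Testing against an arbitrary vector turns a vector identity into a linear
   arithmetic goal over the scalars. *)
Ltac vec J :=
  let w := fresh "w" in apply: (@jinner_inj _ _ J) => w;
  repeat match goal with
  | H : _ = _ |- _ => have := congr1 (fun z => jinner J z w) H; clear H
  end; rewrite ?(jinnerE, jinner0l) /=; lra.

(** * Linearised Jordan identity and Peirce decomposition of an idempotent *)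

Section Peirce.
Variables (R : realType) (V : vectType R) (J : euclideanJordanAlgebra V).

Local Notation "x ** y" := (jmul J x y) (at level 40, left associativity).
Local Notation "''[' u , v ]" := (jinner J u v) : ring_scope.
Implicit Types a b c d x y z u v : V.

(** The difference of the Jordan identities at [x + z] and [x - z] keeps only the parts linear and
    cubic in [z]; the cubic part is the identity for [z] itself. *)
Lemma jordan_lin2 x z y :
  x ** x ** (z ** y) + 2 *: (x ** z ** (x ** y)) =
  z ** (x ** x ** y) + 2 *: (x ** (x ** z ** y)).
Proof.
have := jmul_jordan J (x + z) y; have := jmul_jordan J (x - z) y.
have H := jmul_jordan J z y.
rewrite !jmulE (jmulC J z x) => H1 H2; vec J.
Qed.

(** Polarises the quadratic variable of [jordan_lin2]: the instance at [a + b] minus those at [a]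
    and [b]. *)
Lemma jordan_lin3 a b c d :
  a ** b ** (c ** d) + b ** c ** (a ** d) + c ** a ** (b ** d) =
  c ** (a ** b ** d) + a ** (b ** c ** d) + b ** (c ** a ** d).
Proof.
have H1 := jordan_lin2 (a + b) c d.
have H2 := jordan_lin2 a c d; have H3 := jordan_lin2 b c d.
move: H1; rewrite !jmulE (jmulC J b a) (jmulC J c a) => H1; vec J.
Qed.

(* Both sides of [jordan_lin3] are symmetric in all four variables; compare the
   right-hand sides for [(a, b, c, d)] and [(a, d, c, b)]. *)
Lemma jordan_op a b c d :
  c ** a ** b ** d =
    c ** (a ** b ** d) + a ** (b ** c ** d) + b ** (c ** a ** d)
    - c ** (b ** (a ** d)) - a ** (b ** (c ** d)).
Proof.
have H1 := jordan_lin3 a b c d; have := jordan_lin3 a d c b.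
rewrite (jmulC J (a ** d) (c ** b)) (jmulC J (d ** c)) (jmulC J d b).
rewrite (jmulC J c b) (jmulC J d c) (jmulC J (a ** d) b) (jmulC J _ b).
rewrite (jmulC J (c ** d) b) (jmulC J d) (jmulC J b a) => H2.
vec J.
Qed.

Section Idempotent.
Variable c : V.
Hypothesis cc : jidempotent J c.

(** As t(2t - 1)(t - 1) annihilates L_c, the only possible eigenvalues of L_c are 0, 1/2 and 1. *)
Lemma idem_cubic v :
  2 *: (c ** (c ** (c ** v))) - 3 *: (c ** (c ** v)) + c ** v = 0.
Proof.
have := jordan_op c c c v; rewrite !cc => H; vec J.
Qed.

(* [Pplus] cuts out the sum of the Peirce spaces of [c] for the eigenvalues 1 and
   0, [Pminus] the one for 1/2; [refl] is 1 on the former and -1 on the latter. *)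
Definition Pplus v := c ** (c ** v) = c ** v.
Definition Pminus v := c ** v = 2^-1 *: v.

(** [jordan_lin2] at [c ** z] shows that L_c commutes with L_{cz}; the corresponding terms then
    cancel from the instance at [z]. *)
Lemma Pplus_comm z v : Pplus z -> c ** (z ** v) = z ** (c ** v).
Proof.
move=> zP; have H1 := jordan_lin2 c z v; have H2 := jordan_lin2 c (c ** z) v.
move: H1 H2; rewrite zP !cc => H1 H2; vec J.
Qed.

Lemma PplusM u v : Pplus u -> Pplus v -> Pplus (u ** v).
Proof. by move=> uP vP; rewrite /Pplus !(Pplus_comm _ uP) vP. Qed.

Lemma PplusM_minus u v : Pplus u -> Pminus v -> Pminus (u ** v).
Proof. by move=> uP vM; rewrite /Pminus (Pplus_comm _ uP) vM jmulZr. Qed.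

Lemma PminusM u v : Pminus u -> Pminus v -> Pplus (u ** v).
Proof.
move=> uM vM; have := jordan_lin3 c u v c.
rewrite (jmulC J v c) (jmulC J u c) cc (jmulC J (u ** v) c).
rewrite (jmulC J (c ** u) c) (jmulC J (c ** v) c).
rewrite !uM !vM !jmulE !uM !vM !jmulE (jmulC J v u) /Pplus => H.
vec J.
Qed.

(** The Peirce projection onto the eigenspace 1/2: the polynomial 4t(1 - t) is 1 at 1/2 and 0 at 0
    and 1. *)
Definition pminus v := 4 *: (c ** v - c ** (c ** v)).

Lemma Pminus_pminus v : Pminus (pminus v).
Proof.
by have := idem_cubic v; rewrite /Pminus /pminus !jmulE => H; vec J.
Qed.

Lemma Pplus_pplus v : Pplus (v - pminus v).
Proof.
have := idem_cubic v; have := idem_cubic (c ** v).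
by rewrite /Pplus /pminus !jmulE => H1 H2; vec J.
Qed.

Lemma pminus_plus v : Pplus v -> pminus v = 0.
Proof. by rewrite /Pplus /pminus => ->; rewrite subrr scaler0. Qed.

Lemma pminus_minus v : Pminus v -> pminus v = v.
Proof. by rewrite /Pminus /pminus => vM; rewrite !vM !jmulE vM; vec J. Qed.

Lemma pminusD u v : pminus (u + v) = pminus u + pminus v.
Proof. by rewrite /pminus !jmulE; vec J. Qed.

Definition refl v := v - 2 *: pminus v.

(** [Pplus] and [Pminus] form the even and odd parts of a Z/2-grading of the product, and changing
    the sign of the odd part respects such a grading. *)
Lemma refl_mul u v : refl (u ** v) = refl u ** refl v.
Proof.
have reflE u0 u1 : Pplus u0 -> Pminus u1 -> refl (u0 + u1) = u0 - u1.
  move=> uP uM; rewrite /refl pminusD pminus_plus // pminus_minus //.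
  by vec J.
have peirce x : exists u0 u1, [/\ Pplus u0, Pminus u1 & x = u0 + u1].
  exists (x - pminus x), (pminus x).
  by rewrite subrK; split; [exact: Pplus_pplus | exact: Pminus_pminus |].
have [u0 [u1 [uP uM ->]]] := peirce u; have [v0 [v1 [vP vM ->]]] := peirce v.
rewrite (reflE u0) // (reflE v0) //.
have -> : (u0 + u1) ** (v0 + v1) =
    (u0 ** v0 + u1 ** v1) + (u0 ** v1 + u1 ** v0) by rewrite !jmulE; vec J.
rewrite reflE; first by rewrite !jmulE; vec J.
  by rewrite /Pplus !jmulE (PplusM uP vP) (PminusM uM vM).
rewrite /Pminus (jmulC J u1) !jmulE scalerDr.
by rewrite (PplusM_minus uP vM) (PplusM_minus vP uM).
Qed.

Lemma reflK : involutive refl.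
Proof.
move=> v; rewrite {1}/refl; set u := refl v.
have -> : pminus u = - pminus v; last by rewrite /u /refl; vec J.
have -> : u = (v - pminus v) + - pminus v by rewrite /u /refl; vec J.
rewrite pminusD (pminus_plus (Pplus_pplus v)) add0r.
by rewrite pminus_minus // /Pminus jmulNr Pminus_pminus scalerN.
Qed.

End Idempotent.
End Peirce.

(** * Symmetric operators *)

Section Norm.
Variables (R : realType) (V : vectType R) (J : euclideanJordanAlgebra V).

Local Notation "x ** y" := (jmul J x y) (at level 40, left associativity).
Local Notation "''[' u , v ]" := (jinner J u v) : ring_scope.
Local Notation N := (jnorm J).
Implicit Types x y u v w : V.

Lemma jnorm_ge0 x : 0 <= N x. Proof. exact: sqrtr_ge0. Qed.

Lemma jnorm_sqr x : N x ^+ 2 = '[x, x].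
Proof. by rewrite sqr_sqrtr ?jinner_ge0. Qed.

Lemma jnorm_eq0 x : (N x == 0) = (x == 0).
Proof. by rewrite -(jinner_eq0 J) -jnorm_sqr sqrf_eq0. Qed.

Lemma jnorm0 : N 0 = 0. Proof. by apply/eqP; rewrite jnorm_eq0. Qed.

Lemma jnormZ k x : N (k *: x) = `|k| * N x.
Proof.
by rewrite /jnorm jinnerZl jinnerZr mulrA -expr2 sqrtrM ?sqr_ge0 ?sqrtr_sqr.
Qed.

Lemma jnormN x : N (- x) = N x.
Proof. by rewrite -scaleN1r jnormZ normrN1 mul1r. Qed.

Lemma jinner_le x y : '[x, y] <= N x * N y.
Proof.
have [->|x0] := eqVneq x 0; first by rewrite jinner0l jnorm0 mul0r.
have [->|y0] := eqVneq y 0; first by rewrite jinnerC jinner0l jnorm0 mulr0.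
have Nx : 0 < N x by rewrite lt_def jnorm_eq0 x0 jnorm_ge0.
have Ny : 0 < N y by rewrite lt_def jnorm_eq0 y0 jnorm_ge0.
(* This square equals 2 |x| |y| (|x| |y| - <x, y>). *)
have := jinner_ge0 J (N y *: x - N x *: y).
rewrite !jinnerE (jinnerC J y x) -!jnorm_sqr => H.
rewrite -(ler_pM2l (mulr_gt0 Nx Ny)); lra.
Qed.

Lemma normr_jinner_le x y : `|'[x, y]| <= N x * N y.
Proof.
by rewrite ler_norml jinner_le -(jnormN x) lerNl -jinnerNl jinner_le.
Qed.

Lemma jnormD x y : N (x + y) <= N x + N y.
Proof.
rewrite -(ler_pXn2r (n := 2)) ?nnegrE ?addr_ge0 ?jnorm_ge0 //.
rewrite jnorm_sqr !jinnerE (jinnerC J y x) sqrrD !jnorm_sqr.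
have := jinner_le x y; lra.
Qed.

Lemma jnorm_sum (I : Type) (r : seq I) (P : pred I) (F : I -> V) :
  N (\sum_(i <- r | P i) F i) <= \sum_(i <- r | P i) N (F i).
Proof.
elim/big_rec2: _ => [|i a b _ H]; first by rewrite jnorm0.
by apply: le_trans (jnormD _ _) _; rewrite lerD2l.
Qed.

Lemma orthogonal_complement (W : {vspace V}) u : u \in W -> u != 0 ->
  exists2 W' : {vspace V}, (\dim W' < \dim W)%N &
    forall v, v \in W' <-> v \in W /\ '[v, u] = 0.
Proof.
move=> uW u0; pose W' := (W :&: lker (linfun (jinner J u : V -> R^o)))%VS.
have W'P v : v \in W' <-> v \in W /\ '[v, u] = 0.
  rewrite memv_cap memv_ker lfunE /= jinnerC; split.
    by case/andP => -> /eqP.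
  by case=> -> ->; rewrite eqxx.
exists W' => //; rewrite ltn_neqAle dimvS ?capvSl // andbT.
apply/negP => /eqP dW; have : (W' == W)%VS by rewrite eqEdim capvSl dW leqnn.
move/eqP => eqW; move: uW; rewrite -eqW => /W'P[_ /eqP].
by rewrite jinner_eq0 (negPf u0).
Qed.

(** Gram-Schmidt: a normalised vector of [W] is put in front of a list for its orthogonal complement
    in [W]. *)
Lemma frame_vspace n (W : {vspace V}) : (\dim W <= n)%N ->
  exists2 s : seq V, {subset s <= W} &
    forall v, v \in W -> v = \sum_(b <- s) '[v, b] *: b.
Proof.
elim: n W => [|n IH] W dW.
  exists [::] => // v; move: dW; rewrite leqn0 dimv_eq0 => /eqP->.
  by rewrite memv0 big_nil => /eqP.
have [W0|W0] := eqVneq W 0%VS; first by apply: IH; rewrite W0 dimv0.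
have uW := memv_pick W; have u0 : vpick W != 0 by rewrite vpick0.
set u := vpick W in uW u0.
have [W' dW' W'P] := orthogonal_complement uW u0.
have [|s sW' sP] := IH W'; first by rewrite -ltnS (leq_trans dW').
have Nu : '[u, u] != 0 by rewrite jinner_eq0.
pose b0 := (N u)^-1 *: u.
exists (b0 :: s) => [b|v vW].
  by rewrite inE => /orP[/eqP->|/sW'/W'P[]//]; rewrite memvZ.
rewrite big_cons.
pose v' := v - ('[v, u] / '[u, u]) *: u.
have v'W : v' \in W'.
  apply/W'P; split; first by rewrite memvB ?memvZ.
  by rewrite jinnerDl jinnerNl jinnerZl divfK // subrr.
have -> : \sum_(b <- s) '[v, b] *: b = v'.
  rewrite [RHS]sP //; apply: eq_big_seq => b /sW'/W'P[_ bu].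
  by rewrite jinnerDl jinnerNl jinnerZl (jinnerC J u) bu mulr0 subr0.
rewrite /b0 jinnerZr scalerA -mulrA mulrCA -expr2 exprVn jnorm_sqr.
by rewrite addrC subrK.
Qed.

Lemma frame_exists :
  exists s : seq V, forall v, v = \sum_(b <- s) '[v, b] *: b.
Proof.
have [s _ sP] := frame_vspace (leqnn (\dim {:V})).
by exists s => v; apply: sP; rewrite memvf.
Qed.

Lemma lfun_bounded (T : 'End(V)) :
  exists2 C : R, 0 < C & forall v, N (T v) <= C * N v.
Proof.
have [s sP] := frame_exists.
(* The bound comes from expanding [v] in the frame; the summand 1 makes it positive. *)
exists (1 + \sum_(b <- s) N b * N (T b)).
  by rewrite ltr_wpDr // sumr_ge0 // => b _; rewrite mulr_ge0 ?jnorm_ge0.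
move=> v; rewrite {1}(sP v) linear_sum; apply: le_trans (jnorm_sum _ _ _) _.
apply: (@le_trans _ _ ((\sum_(b <- s) N b * N (T b)) * N v)).
  rewrite mulr_suml; apply: ler_sum => b _.
  rewrite linearZ jnormZ mulrAC ler_wpM2r ?jnorm_ge0 // mulrC.
  exact: normr_jinner_le.
by rewrite ler_wpM2r ?jnorm_ge0 // lerDr ler01.
Qed.

Lemma jmul_bounded :
  exists2 C : R, 0 < C & forall x y, N (x ** y) <= C * N x * N y.
Proof.
have [s sP] := frame_exists.
have bounded b : exists k, 0 < k /\ forall v, N (b ** v) <= k * N v.
  have [C C0 CP] := lfun_bounded (Lop J b); exists C; split => // v.
  by have := CP v; rewrite lfunE.
have [g gP] := boolp.choice bounded.
exists (1 + \sum_(b <- s) N b * g b).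
  rewrite ltr_wpDr // sumr_ge0 // => b _; rewrite mulr_ge0 ?jnorm_ge0 //.
  by case: (gP b) => /ltW.
move=> x y; rewrite {1}(sP x) jmul_suml; apply: le_trans (jnorm_sum _ _ _) _.
apply: (@le_trans _ _ ((\sum_(b <- s) N b * g b) * N x * N y)).
  rewrite !mulr_suml; apply: ler_sum => b _.
  rewrite jmulZl jnormZ; have [g0 gb] := gP b.
  have -> : N b * g b * N x * N y = (N x * N b) * (g b * N y) by lra.
  by rewrite ler_pM ?jnorm_ge0 ?normr_jinner_le.
by rewrite !ler_wpM2r ?jnorm_ge0 // lerDr ler01.
Qed.

End Norm.

Section SpectralTheorem.
Variables (R : realType) (V : vectType R) (J : euclideanJordanAlgebra V).

Local Notation "x ** y" := (jmul J x y) (at level 40, left associativity).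
Local Notation "''[' u , v ]" := (jinner J u v) : ring_scope.
Local Notation N := (jnorm J).
Implicit Types x y u v w : V.

(** Replaces a compactness argument: injectivity gives a bounded inverse, hence |v|^2 <= C1^2 |S
    v|^2, and positivity gives |S v|^2 <= C2 <S v, v>. *)
Lemma selfadjoint_coercive (S : 'End(V)) (W : {vspace V}) :
    (forall u v, '[S u, v] = '[u, S v]) ->
    (forall v, v \in W -> S v \in W) ->
    (forall v, v \in W -> 0 <= '[S v, v]) ->
    (forall v, v \in W -> S v = 0 -> v = 0) ->
  exists2 e : R, 0 < e & forall v, v \in W -> e * '[v, v] <= '[S v, v].
Proof.
move=> S_sym SW S_ge0 S_inj.
(* [S'] is [S] on [W] and the identity on a complement, so it is invertible on the whole space. *)
pose S' := (S \o projv W + (\1 - projv W))%VF.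
have S'E v : v \in W -> S' v = S v.
  move=> vW; rewrite add_lfunE comp_lfunE add_lfunE opp_lfunE id_lfunE.
  by rewrite projv_id // subrr addr0.
have kerS' : lker S' == 0%VS.
  rewrite -subv0; apply/subvP => v; rewrite memv_ker memv0.
  rewrite add_lfunE comp_lfunE add_lfunE opp_lfunE id_lfunE.
  move=> /eqP Sv.
  have qW : v - projv W v \in W.
    move/(canRL (addKr _)): Sv => ->.
    by rewrite addr0 memvN SW ?memv_proj.
  have q0 : v - projv W v = 0.
    by apply/eqP; rewrite -memv0 -(capv_compl W) memv_cap qW memv_projC.
  move: Sv; rewrite q0 addr0 => /S_inj Sv; move/eqP: q0.
  by rewrite Sv ?subr0 ?memv_proj.
pose G := (S'^-1)%VF.
have GS v : v \in W -> G (S v) = v by move=> vW; rewrite -S'E // lker0_lfunK.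
have [C1 C1_gt0 C1P] := lfun_bounded J G.
have [C2 C2_gt0 C2P] := lfun_bounded J S.
exists (C2 * C1 ^+ 2)^-1; first by rewrite invr_gt0 mulr_gt0 ?exprn_gt0.
move=> v vW; rewrite ler_pdivrMl ?mulr_gt0 ?exprn_gt0 //.
have vSv : '[v, v] <= C1 ^+ 2 * '[S v, S v].
  rewrite -!(jnorm_sqr J) -exprMn.
  rewrite ler_pXn2r ?nnegrE ?mulr_ge0 ?jnorm_ge0 ?(ltW C1_gt0) //.
  by rewrite -{1}(GS v vW).
apply: le_trans vSv _.
rewrite [C2 * _]mulrC -[X in _ <= X]mulrA ler_pM2l ?exprn_gt0 //.
have SSv : '[S (S v), S v] <= C2 * '[S v, S v].
  apply: le_trans (jinner_le _ _ _) _; rewrite -jnorm_sqr expr2 mulrA.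
  by rewrite ler_wpM2r ?jnorm_ge0.
(* [0 <= <S w, w>] at [w = C2 v - S v] gives [|S v|^2 <= C2 <S v, v>]. *)
have := S_ge0 (C2 *: v - S v) (memvB (memvZ _ vW) (SW _ vW)).
have -> : S (C2 *: v - S v) = C2 *: S v - S (S v) by rewrite linearB linearZ.
rewrite !jinnerE (S_sym (S v) v) => H.
rewrite -(ler_pM2l C2_gt0); lra.
Qed.

(* The supremum [M] of the Rayleigh quotient is an eigenvalue: otherwise [M - T]
   would be coercive on [W], making [M] too large. *)
Lemma eigenvector_exists (T : 'End(V)) (W : {vspace V}) :
    (forall u v, '[T u, v] = '[u, T v]) ->
    (forall v, v \in W -> T v \in W) -> W != 0%VS ->
  exists v a, [/\ v \in W, v != 0 & T v = a *: v].
Proof.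
move=> T_sym TW W0; apply: contrapT => no_eigen.
pose A : set R := [set r | exists v,
  [/\ v \in W, v != 0 & r = '[T v, v] / '[v, v]]]%classic.
have [C C_gt0 CP] := lfun_bounded J T.
have supA : has_sup A.
  split.
    by exists ('[T (vpick W), vpick W] / '[vpick W, vpick W]), (vpick W);
       rewrite memv_pick vpick0.
  exists C => _ [v [vW v0 ->]].
  rewrite ler_pdivrMr ?jinner_gt0 //; apply: le_trans (jinner_le _ _ _) _.
  by rewrite -jnorm_sqr expr2 mulrA ler_wpM2r ?jnorm_ge0.
pose S : 'End(V) := (sup A *: \1 - T)%VF.
have SE v : S v = sup A *: v - T v.
  by rewrite add_lfunE opp_lfunE scale_lfunE id_lfunE.
have [||||e e_gt0 eP] := @selfadjoint_coercive S W.
- by move=> u v; rewrite !SE !jinnerE T_sym.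
- by move=> v vW; rewrite SE memvB ?memvZ ?TW.
- move=> v vW; rewrite SE !jinnerE subr_ge0.
  have [->|v0] := eqVneq v 0; first by rewrite linear0 !jinner0l mulr0.
  rewrite -ler_pdivrMr ?jinner_gt0 //; apply: sup_upper_bound => //.
  by exists v.
- move=> v vW /eqP; rewrite SE subr_eq0 => /eqP Tv.
  by apply/eqP/negPn/negP => v0; apply: no_eigen; exists v, (sup A).
have : sup A <= sup A - e.
  apply: ge_sup; first by case: supA.
  move=> _ [v [vW v0 ->]]; rewrite ler_pdivrMr ?jinner_gt0 //.
  by have := eP v vW; rewrite SE !jinnerE; lra.
lra.
Qed.

(** An eigenvector is split off and induction applies to its orthogonal complement. Indexing the
    components by distinct eigenvalues merges equal ones, so no eigenbasis is carried along. *)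
Lemma spectral_theorem (T : 'End(V)) v :
    (forall u v, '[T u, v] = '[u, T v]) ->
  exists (s : seq R) (f : R -> V),
    [/\ uniq s, forall a, T (f a) = a *: f a & v = \sum_(a <- s) f a].
Proof.
move=> T_sym.
suff: forall n (W : {vspace V}), (\dim W <= n)%N ->
    (forall v, v \in W -> T v \in W) -> forall v, v \in W ->
  exists (s : seq R) (f : R -> V),
    [/\ uniq s, forall a, T (f a) = a *: f a & v = \sum_(a <- s) f a].
  by move/(_ _ fullv (leqnn _)); apply; rewrite ?memvf // => *; rewrite memvf.
elim=> [|n IH] W dW TW {}v vW.
  exists [::], (fun=> 0); rewrite big_nil; split=> // [a|].
    by rewrite linear0 scaler0.
  by move: dW vW; rewrite leqn0 dimv_eq0 => /eqP->; rewrite memv0 => /eqP.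
have [W0|W0] := eqVneq W 0%VS.
  by apply: (IH W) => //; rewrite W0 dimv0.
have [u [b [uW u0 Tu]]] := eigenvector_exists T_sym TW W0.
have [W' dW' W'P] := orthogonal_complement J uW u0.
pose k := '[v, u] / '[u, u].
have Nu : '[u, u] != 0 by rewrite jinner_eq0.
have [|||s [f [s_uniq fP v'E]]] := IH W' _ _ (v - k *: u) _.
- by rewrite -ltnS (leq_trans dW').
- move=> w /W'P[wW wu]; apply/W'P; split; first exact: TW.
  by rewrite T_sym Tu jinnerZr wu mulr0.
- apply/W'P; split; first by rewrite memvB ?memvZ.
  by rewrite jinnerDl jinnerNl jinnerZl divfK // subrr.
(* [f] is cut off outside [s], where its values are arbitrary eigenvectors; [b] may already occur in
   [s], and then the two components add up. *)
pose g a := (if a \in s then f a else 0) + (if a == b then k *: u else 0).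
have := undup_uniq (b :: s); have := mem_undup (b :: s).
move: (undup _) => t tE t_uniq.
exists t, g; split=> // [a|].
  rewrite /g linearD /= scalerDr; congr (_ + _).
    by case: ifP; rewrite ?linear0 ?scaler0.
  case: eqP => [->|_]; rewrite ?linear0 ?scaler0 //.
  by rewrite linearZ /= Tu !scalerA mulrC.
have vE : v = \sum_(a <- s) f a + k *: u by rewrite -v'E subrK.
rewrite vE big_split /=; congr (_ + _).
  rewrite -[RHS]big_mkcond /= -[RHS]big_filter; apply: perm_big.
  apply: uniq_perm; rewrite ?filter_uniq // => a.
  by rewrite mem_filter tE inE; case: (a \in s); rewrite ?orbT ?andbF.
rewrite -[RHS]big_mkcond /= -[RHS]big_filter filter_pred1_uniq ?big_seq1 //.
by rewrite tE mem_head.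
Qed.

End SpectralTheorem.

(** * Spectral idempotents and curves in automorphism orbits *)

Section JordanSpectral.
Variables (R : realType) (V : vectType R) (J : euclideanJordanAlgebra V).

Local Notation "x ** y" := (jmul J x y) (at level 40, left associativity).
Local Notation "''[' u , v ]" := (jinner J u v) : ring_scope.
Local Notation N := (jnorm J).
Local Notation e := (junit J).
Implicit Types x y u v w : V.

(** [P] stands for a T-invariant subspace. Applying T - b removes [f b] and multiplies every other
    [f a] by a - b, which is nonzero; subtracting the recovered components leaves [f b]. *)
Lemma eigen_component (T : 'End(V)) (P : V -> Prop) (s : seq R) (f : R -> V) :
    (forall u v, P u -> P v -> P (u + v)) ->
    (forall k v, P v -> P (k *: v)) -> (forall v, P v -> P (T v)) ->
    uniq s -> (forall a, T (f a) = a *: f a) -> P (\sum_(a <- s) f a) ->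
  forall a, a \in s -> P (f a).
Proof.
move=> PD PZ PT; elim: s f => [|b s IH] f /=; first by [].
move=> /andP[bs s_uniq] fP.
rewrite big_cons => Pf.
have Ps a : a \in s -> P (f a).
  move=> sa; have ab : a - b != 0.
    by rewrite subr_eq0; apply: contraNneq bs => <-.
  rewrite -[f a]scale1r -(mulVf ab) -scalerA; apply: (PZ).
  apply: (IH (fun a => (a - b) *: f a)) => // [c|].
    by rewrite linearZ /= fP !scalerA mulrC.
  have -> : \sum_(c <- s) (c - b) *: f c =
            T (f b + \sum_(c <- s) f c) + (- b) *: (f b + \sum_(c <- s) f c).
    rewrite linearD linear_sum /= fP scalerDr scaleNr addrACA subrr add0r.
    rewrite scaler_sumr -big_split /=; apply: eq_bigr => c _.
    by rewrite fP scalerBl scaleNr.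
  by apply: (PD); [apply: (PT) | apply: (PZ)].
move=> a; rewrite inE => /orP[/eqP->|/Ps//].
have -> : f b = (f b + \sum_(c <- s) f c) + (-1) *: \sum_(c <- s) f c.
  by rewrite scaleN1r addrK.
apply: (PD) => //; apply: (PZ).
have P0 : P 0 by rewrite -(scale0r (f b + \sum_(c <- s) f c)); exact: PZ.
by rewrite big_seq; elim/big_ind: _ => // c; exact: Ps.
Qed.

(* A property of the powers of [x] that is strong enough to be preserved by
   multiplication by [x]: both [L_y] and [L_{xy}] commute with [L_x]. *)
Definition power_like x y := forall v,
  x ** (y ** v) = y ** (x ** v) /\ x ** (x ** y ** v) = x ** y ** (x ** v).

Lemma power_like_unit x : power_like x e.
Proof. by move=> v; rewrite (jmulC J x e) !jmul1x. Qed.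

Lemma power_like_mul x y : power_like x y -> power_like x (x ** y).
Proof.
move=> xy v; split; first exact: (xy v).2.
(* This writes L_{x(xy)} through L_x, L_y, L_{xy} and L_{xx}, all of which commute with L_x. *)
have opE w : x ** (x ** y) ** w = 2 *: (x ** (x ** y ** w)) +
    y ** (x ** x ** w) - x ** (x ** (y ** w)) - y ** (x ** (x ** w)).
  have := jordan_op J y x x w.
  by rewrite (jmulC J (x ** y)) (jmulC J y x) => H; vec J.
rewrite !opE !jmulE (xy v).1 (xy v).2 (xy (x ** x ** v)).1 (xy (x ** v)).1.
by rewrite (xy (x ** (x ** v))).1 -jmul_jordan.
Qed.

(** The components of the unit under L_x inherit [power_like] from it. Then [c a ** c b] is an
    eigenvector of L_x for both a and b, hence 0 when they differ, and multiplying [c a] by the unit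
    gives idempotency. *)
Lemma jordan_spectral x : exists (s : seq R) (c : R -> V),
  [/\ uniq s, \sum_(a <- s) c a = e, forall a, x ** c a = a *: c a,
      forall a, a \in s -> jidempotent J (c a) &
      forall a b, a \in s -> b \in s -> a != b -> c a ** c b = 0].
Proof.
have Lx_sym u v : '[Lop J x u, v] = '[u, Lop J x v].
  by rewrite !lfunE /= jinner_assoc.
have [s [c [s_uniq cP eE]]] := spectral_theorem e Lx_sym.
have xc a : x ** c a = a *: c a by rewrite -cP lfunE.
have cx a : a \in s -> power_like x (c a).
  apply: (@eigen_component (Lop J x)) => //; rewrite -?eE.
  - move=> u v xu xv w; have [xu1 xu2] := xu w; have [xv1 xv2] := xv w.
    by rewrite !jmulE xu1 xu2 xv1 xv2.
  - by move=> k v xv w; have [xv1 xv2] := xv w; rewrite !jmulE xv1 xv2.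
  - by move=> v xv; rewrite lfunE /=; exact: power_like_mul.
  - exact: power_like_unit.
have orth a b : a \in s -> b \in s -> a != b -> c a ** c b = 0.
  move=> sa sb; rewrite -subr_eq0 => ab.
  have := (cx b sb (c a)).1; have := (cx a sa (c b)).1.
  rewrite !xc !jmulZr (jmulC J (c b)) => -> /eqP.
  by rewrite eq_sym -subr_eq0 -scalerBl scaler_eq0 (negPf ab) => /eqP.
exists s, c; split=> // a sa; rewrite /jidempotent.
rewrite -[RHS](jmul1x J) jmulC eE jmul_sumr (bigD1_seq a) //=.
rewrite big1_seq ?addr0 // => b /andP[ba sb].
by rewrite orth // eq_sym.
Qed.

End JordanSpectral.

(** * Square roots of the unit, their automorphisms, and tangents to orbits *)

Section Involutions.
Variables (R : realType) (V : vectType R) (J : euclideanJordanAlgebra V).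

Local Notation "x ** y" := (jmul J x y) (at level 40, left associativity).
Local Notation "''[' u , v ]" := (jinner J u v) : ring_scope.
Local Notation N := (jnorm J).
Local Notation e := (junit J).
Implicit Types c x y u v w : V.

Lemma jmulx1 x : x ** e = x. Proof. by rewrite jmulC jmul1x. Qed.

(** When [w ** w = e] this is the quadratic representation 2 L_w^2 - L_{w^2} of [w]. *)
Definition quad w : 'End(V) := (2 *: (Lop J w \o Lop J w) - \1)%VF.

Lemma quadE w v : quad w v = 2 *: (w ** (w ** v)) - v.
Proof.
by rewrite add_lfunE opp_lfunE scale_lfunE comp_lfunE id_lfunE !lfunE.
Qed.

Lemma quad_refl c v : quad (2 *: c - e) v = refl J c v.
Proof. by rewrite quadE /refl /pminus !jmulE !jmul1x; vec J. Qed.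

(** Since (e + w)/2 is idempotent, [quad w] is its Peirce reflection. *)
Lemma quad_jaut w : w ** w = e -> jaut J (quad w).
Proof.
move=> ww; pose c := 2^-1 *: (e + w).
have cc : jidempotent J c.
  by rewrite /jidempotent /c !jmulE ww !jmulx1 jmul1x; vec J.
have -> : w = 2 *: c - e by rewrite /c; clear - J; vec J.
split; last by move=> a b; rewrite !quad_refl refl_mul.
by exists (refl J c) => v; rewrite quad_refl reflK.
Qed.

(* [w] is the sign of [q], and [|sgn a - a| <= |a^2 - 1|] on the spectrum. *)
Lemma sign_approx q : exists2 w, w ** w = e & N (w - q) <= N (q ** q - e).
Proof.
(* The value at 0 is 1, so that [sg] always squares to 1. *)
pose sg (a : R) : R := if a < 0 then -1 else 1.
have sgP a : sg a * sg a = 1 by rewrite /sg; case: ifP; rewrite ?mulrNN mulr1.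
(* Up to sign, one factor of a^2 - 1 is [sg a - a]; the other has absolute value at least 1. *)
have sg_approx a : (sg a - a) ^+ 2 <= (a * a - 1) ^+ 2.
  rewrite /sg; case: ltP => a0.
    have -> : (a * a - 1) ^+ 2 = (-1 - a) ^+ 2 * (1 - a) ^+ 2 by lra.
    by rewrite ler_peMr ?sqr_ge0 // exprn_ege1 //; lra.
  have -> : (a * a - 1) ^+ 2 = (1 - a) ^+ 2 * (1 + a) ^+ 2 by lra.
  by rewrite ler_peMr ?sqr_ge0 // exprn_ege1 //; lra.
have [s [c [s_uniq eE qc cc orth]]] := jordan_spectral J q.
have mulE (g h : R -> R) :
    (\sum_(a <- s) g a *: c a) ** (\sum_(a <- s) h a *: c a) =
    \sum_(a <- s) (g a * h a) *: c a.
  rewrite jmul_suml; apply: eq_big_seq => a sa.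
  rewrite jmul_sumr (bigD1_seq a) //= big1_seq ?addr0 => [|b /andP[ba sb]].
    by rewrite jmulZl jmulZr cc // scalerA.
  by rewrite jmulZl jmulZr orth ?scaler0 // eq_sym.
have qE : q = \sum_(a <- s) a *: c a.
  rewrite -{1}[q]jmulx1 -eE jmul_sumr; exact: eq_bigr.
have eE1 : e = \sum_(a <- s) 1 *: c a.
  by rewrite -eE; apply: eq_bigr => a _; rewrite scale1r.
have normE (g : R -> R) : N (\sum_(a <- s) g a *: c a) ^+ 2 =
    \sum_(a <- s) g a ^+ 2 * '[c a, c a].
  rewrite jnorm_sqr -{1}[\sum_(a <- s) _]jmulx1 jinner_assoc mulE.
  rewrite jinnerC jinner_suml; apply: eq_big_seq => a sa.
  by rewrite jinnerZl -{1}(cc a sa) jinner_assoc jmulx1.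
exists (\sum_(a <- s) sg a *: c a).
  by rewrite mulE [RHS]eE1; apply: eq_bigr => a _; rewrite sgP.
rewrite qE mulE {1}eE1 -!sumrB.
under eq_bigr do rewrite -scalerBl.
under [in X in _ <= X]eq_bigr do rewrite -scalerBl.
rewrite -(ler_pXn2r (n := 2)) ?nnegrE ?jnorm_ge0 // !normE.
by apply: ler_sum => a _; rewrite ler_wpM2r ?jinner_ge0.
Qed.

(** [w0] annihilates the Peirce space 1/2, which contains both [u] and [u ** x], and L_{w0} squares
    to the identity at [x]. Hence the only first-order term of [quad w x] is 2t u(w0 x). *)
Lemma orbit_curve c x u : jidempotent J c -> Pplus J c x -> Pminus J c u ->
  exists2 C : R, 0 < C & forall t : R, `|t| <= 1 -> exists2 X, jaut J X &
    N (X x - x - t *: (2 *: (u ** ((2 *: c - e) ** x)))) <= C * t ^+ 2.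
Proof.
move=> cc xP uM; set w0 := 2 *: c - e.
have w0w0 : w0 ** w0 = e by rewrite /w0 !jmulE !jmulx1 !jmul1x cc; vec J.
have w0u : w0 ** u = 0 by rewrite /w0 !jmulE jmul1x uM; vec J.
have w0ux : w0 ** (u ** x) = 0.
  rewrite /w0 !jmulE jmul1x (jmulC J u x) (PplusM_minus cc xP uM); vec J.
have w0w0x : w0 ** (w0 ** x) = x.
  by rewrite /w0 !jmulE !jmul1x (xP : c ** (c ** x) = c ** x); vec J.
clearbody w0.
have [B B_gt0 BP] := jmul_bounded J.
(* A bound for both [N w] and [N q] when |t| <= 1. *)
pose K := N w0 + N u + N (u ** u).
have K_ge0 : 0 <= K by rewrite !addr_ge0 ?jnorm_ge0.
exists (1 + 2 * N (u ** (u ** x)) + 4 * (B * B * K * N x * N (u ** u))).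
  have := jnorm_ge0 J (u ** (u ** x)); have : 0 <= B * B * K * N x * N (u ** u).
    by rewrite !mulr_ge0 ?jnorm_ge0 // ltW.
  lra.
move=> t t1; pose q := w0 + t *: u.
have [w ww wq] := sign_approx q; pose r := w - q.
have wE : w = w0 + t *: u + r by rewrite /r addrC subrK.
have rP : N r <= t ^+ 2 * N (u ** u).
  apply: le_trans wq _; rewrite -[X in X * _](ger0_norm (sqr_ge0 t)) -jnormZ.
  have -> // : q ** q - e = t ^+ 2 *: (u ** u).
  by rewrite /q !jmulE (jmulC J u w0) w0u w0w0; vec J.
clearbody r.
have t2 : t ^+ 2 <= 1 by rewrite -real_normK ?num_real // expr_le1.
exists (quad w); first exact: quad_jaut.
have Nw : N w <= K.
  rewrite wE; do 2?[apply: le_trans (jnormD _ _ _) _; apply: lerD] => //.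
    by rewrite jnormZ ler_piMl ?jnorm_ge0.
  by apply: le_trans rP _; rewrite ler_piMl ?jnorm_ge0.
have Nq : N q <= K.
  apply: le_trans (jnormD _ _ _) _; rewrite /K -addrA lerD2l jnormZ.
  by rewrite -[leLHS]addr0 lerD ?jnorm_ge0 // ler_piMl ?jnorm_ge0.
have -> : quad w x - x - t *: (2 *: (u ** (w0 ** x))) =
    (2 * t ^+ 2) *: (u ** (u ** x)) +
    (2 *: (q ** (r ** x)) + 2 *: (r ** (w ** x))).
  rewrite quadE.
  have -> : w ** (w ** x) = q ** (q ** x) + q ** (r ** x) + r ** (w ** x).
    by rewrite {1}wE -/q jmulDl {1}wE -/q (jmulDl J q r) jmulDr.
  rewrite /q !jmulE w0ux w0w0x; vec J.
pose D := B * B * K * N x * N r.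
have qrx : N (q ** (r ** x)) <= D.
  apply: le_trans (BP _ _) _.
  have -> : D = (B * K) * (B * N r * N x) by rewrite /D; lra.
  by rewrite ler_pM ?mulr_ge0 ?jnorm_ge0 ?(ltW B_gt0) // ler_pM2l.
have rwx : N (r ** (w ** x)) <= D.
  apply: le_trans (BP _ _) _.
  have -> : D = (B * N r) * (B * K * N x) by rewrite /D; lra.
  rewrite ler_pM ?mulr_ge0 ?jnorm_ge0 ?(ltW B_gt0) //.
  apply: le_trans (BP _ _) _.
  by rewrite ler_wpM2r ?jnorm_ge0 // ler_pM2l.
have DP : D <= B * B * K * N x * (t ^+ 2 * N (u ** u)).
  by rewrite ler_wpM2l // !mulr_ge0 ?jnorm_ge0 // ltW.
apply: le_trans (jnormD _ _ _) _; rewrite jnormZ.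
rewrite (ger0_norm (mulr_ge0 (ler0n R 2) (sqr_ge0 t))).
have := jnormD J (2 *: (q ** (r ** x))) (2 *: (r ** (w ** x))).
rewrite !jnormZ (ger0_norm (ler0n R 2)).
have := sqr_ge0 t; clear w0w0 w0u w0ux w0w0x ww wE; lra.
Qed.

(** On the Peirce space 1/2 of [c], L_{c+d} is 1/2 + L_d. Subtracting the idempotent cubic at t from
    that at t + 1/2 leaves (3/2)(2t^2 - t). *)
Lemma Pminus_half c d v : jidempotent J c -> jidempotent J d -> c ** d = 0 ->
  Pminus J c v -> 2 *: (d ** (d ** v)) = d ** v.
Proof.
move=> cc dd cd vM.
have dP : Pplus J c d by rewrite /Pplus cd jmul0r.
have dvM := PplusM_minus cc dP vM; have ddvM := PplusM_minus cc dP dvM.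
have sum_idem : jidempotent J (c + d).
  by rewrite /jidempotent !jmulE (jmulC J d) cd cc dd addr0 add0r.
have H1 := idem_cubic dd v; have := idem_cubic sum_idem v.
rewrite /Pminus in vM dvM ddvM.
rewrite !(jmulE, vM, dvM, ddvM) => H2.
vec J.
Qed.

(** On [c a ** v] the operator L_x acts as (k + a)/2, so the map u -> 2 u(w0 x) multiplies it by k -
    a and can be inverted componentwise. *)
Lemma eigenprojection_onto x (s : seq R) (c : R -> V) k v :
    uniq s -> \sum_(a <- s) c a = e -> (forall a, x ** c a = a *: c a) ->
    (forall a, a \in s -> jidempotent J (c a)) ->
    (forall a b, a \in s -> b \in s -> a != b -> c a ** c b = 0) ->
    k \in s -> Pminus J (c k) v ->
  exists2 u, Pminus J (c k) u & 2 *: (u ** ((2 *: c k - e) ** x)) = v.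
Proof.
move=> s_uniq eE xc cc orth sk vM.
have xE : x = \sum_(a <- s) a *: c a.
  by rewrite -{1}[x]jmulx1 -eE jmul_sumr; apply: eq_bigr.
have PP a b : a \in s -> b \in s -> Pplus J (c a) (c b).
  move=> sa sb; rewrite /Pplus; have [->|ab] := eqVneq a b.
    by rewrite !cc.
  by rewrite orth // jmul0r.
have cv a : a \in s -> Pminus J (c k) (c a ** v).
  by move=> sa; apply: PplusM_minus => //; [exact: cc | exact: PP].
have half a : a \in s -> a != k -> 2 *: (c a ** (c a ** v)) = c a ** v.
  move=> sa ak; apply: (Pminus_half (cc k sk) (cc a sa)) => //.
  by rewrite orth // eq_sym.
(* Comparing [Pminus_half] for [c a + c b] with its instances for [c a] and [c b] isolates the mixed
   term. *)
have cross a b : a \in s -> b \in s -> a != k -> b != k -> a != b ->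
    c a ** (c b ** v) = 0.
  move=> sa sb ak bk ab.
  have sum_idem : jidempotent J (c a + c b).
    rewrite /jidempotent !jmulE (jmulC J (c b) (c a)) (orth a b) //.
    by rewrite addr0 add0r (cc a sa) (cc b sb).
  have : 2 *: ((c a + c b) ** ((c a + c b) ** v)) = (c a + c b) ** v.
    apply: (Pminus_half (cc k sk) sum_idem) => //.
    by rewrite jmulDr (orth k a) ?(orth k b) ?addr0 // eq_sym.
  have Ha := half a sa ak; have Hb := half b sb bk.
  rewrite !jmulE (Pplus_comm (cc b sb) v (PP b a sb sa)) => H.
  clear eE xc cc orth vM xE PP cv half; vec J.
have xcv a : a \in s -> a != k -> x ** (c a ** v) = ((k + a) / 2) *: (c a ** v).
  move=> sa ak; rewrite {1}xE jmul_suml (bigD1_seq k) //= -big_filter.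
  rewrite (bigD1_seq a) ?mem_filter ?ak ?sa ?filter_uniq //=.
  rewrite big1_seq => [|b /andP[ba]]; last first.
    by rewrite mem_filter => /andP[bk sb]; rewrite jmulZl cross ?scaler0.
  rewrite addr0 !jmulZl (cv a sa : c k ** _ = _).
  have -> : c a ** (c a ** v) = 2^-1 *: (c a ** v).
    by rewrite -{2}(half a sa ak) scalerA mulVf ?scale1r ?pnatr_eq0.
  clear; rewrite !scalerA -scalerDl; congr (_ *: _); lra.
(* The map turns each summand into [2 *: (c a ** v)]; these add up to 2(e - c_k)v = v. *)
pose u := \sum_(a <- s | a != k) (2 / (k - a)) *: (c a ** v).
have uM : Pminus J (c k) u.
  rewrite /Pminus jmul_sumr scaler_sumr big_seq_cond [RHS]big_seq_cond.
  apply: eq_bigr => a /andP[sa _].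
  by rewrite jmulZr (cv a sa : c k ** _ = _) !scalerA mulrC.
exists u => //.
have -> : 2 *: (u ** ((2 *: c k - e) ** x)) = 2 *: (k *: u - x ** u).
  rewrite !jmulE jmul1x (jmulC J (c k)) xc !jmulE.
  rewrite (jmulC J u (c k)) (jmulC J u x).
  by rewrite (uM : c k ** u = _) /=; clear - J; vec J.
rewrite jmul_sumr !scaler_sumr -sumrB scaler_sumr.
rewrite big_seq_cond (eq_bigr (fun a => 2 *: (c a ** v))) => [|a /andP[sa ak]].
  rewrite -big_seq_cond -scaler_sumr -jmul_suml.
  have -> : \sum_(a <- s | a != k) c a = e - c k.
    by rewrite -eE (bigD1_seq k sk s_uniq) /= [c k + _]addrC addrK.
  by rewrite !jmulE jmul1x (vM : c k ** v = _); clear - J; vec J.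
have ka : k - a != 0 by rewrite subr_eq0 eq_sym.
rewrite jmulZr xcv // !scalerA -scalerBl scalerA; congr (_ *: _).
rewrite [_ * (2 / _)]mulrC -mulrBr.
have -> : k - (k + a) / 2 = (k - a) / 2 by clear; lra.
by rewrite -(invf_div (k - a)) mulVf ?mulr1 // mulf_neq0 ?invr_neq0 ?pnatr_eq0.
Qed.

End Involutions.

(** * Convexity and invariance *)

Section Convexity.
Variables (R : realType) (V : vectType R) (J : euclideanJordanAlgebra V).

Local Notation "''[' u , v ]" := (jinner J u v) : ring_scope.
Local Notation N := (jnorm J).
Implicit Types x y z u v w : V.

Definition convex_fun (F : V -> R) := forall x y (t : R), 0 <= t -> t <= 1 ->
  F (t *: x + (1 - t) *: y) <= t * F x + (1 - t) * F y.

(** What both kinds of strict convexity share: a norm is linear along rays, so strictness is asked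
    only between points of equal value. *)
Definition strict_on_levels (F : V -> R) := forall x y, F x = F y -> x != y ->
  F (2^-1 *: (x + y)) < F x.

Lemma strictly_convex_convex F : strictly_convex_function F -> convex_fun F.
Proof.
move=> Fc x y t t0 t1.
have [->|xy] := eqVneq x y.
  by rewrite -scalerDl -mulrDl [t + _]addrC subrK scale1r mul1r.
have [->|tn0] := eqVneq t 0.
  by rewrite scale0r add0r mul0r add0r subr0 scale1r mul1r.
have [->|tn1] := eqVneq t 1.
  by rewrite subrr !scale0r mul0r !addr0 scale1r mul1r.
by apply/ltW/Fc => //; rewrite lt_neqAle ?t0 ?t1 ?tn1 // eq_sym tn0.
Qed.

Lemma strictly_convex_levels F :
  strictly_convex_function F -> strict_on_levels F.
Proof.
move=> Fc x y Fxy xy; rewrite scalerDr.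
have := Fc x y 2^-1 xy; have -> : 1 - 2^-1 = 2^-1 :> R by lra.
by rewrite -Fxy => H; apply: (lt_le_trans (H _ _)); lra.
Qed.

Lemma norm_convex (F : V -> R) : is_norm F -> convex_fun F.
Proof.
case=> _ _ FZ FD x y t t0 t1; apply: le_trans (FD _ _) _.
by rewrite !FZ !ger0_norm ?subr_ge0.
Qed.

(** Both vectors are scaled to the unit sphere by the inverse of their common norm, which is
    positive because they differ. *)
Lemma strictly_convex_norm_levels F :
  strictly_convex_norm F -> strict_on_levels F.
Proof.
case=> -[F_ge0 F_eq0 FZ FD] Fc x y Fxy xy.
have Fx : 0 < F x.
  rewrite lt_def F_ge0 andbT; apply: contraNneq xy => Fx0.
  by rewrite (F_eq0 x) // (F_eq0 y) // -Fxy.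
have Fx_neq0 : F x != 0 by rewrite gt_eqF.
pose k := (F x)^-1; have k_gt0 : 0 < k by rewrite invr_gt0.
have k_neq0 : k != 0 by rewrite gt_eqF.
have F0 : F 0 = 0 by rewrite -(scale0r x) FZ normr0 mul0r.
have x0 : x != 0 by apply: contraNneq Fx_neq0 => ->; rewrite F0.
have y0 : y != 0 by apply: contraNneq Fx_neq0; rewrite Fxy => ->; rewrite F0.
have := Fc (k *: x) (k *: y); rewrite !scaler_eq0 !negb_or k_neq0 x0 y0.
rewrite (inj_eq (scalerI k_neq0)) xy -scalerDr !FZ -Fxy gtr0_norm // mulVf //.
move=> /(_ isT isT isT erefl erefl).
rewrite ltr_pdivrMl // => H; rewrite gtr0_norm ?invr_gt0 ?ltr0n //; lra.
Qed.

Lemma convex_line (F : V -> R) y b (eps : R) : convex_fun F -> 0 < eps ->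
  exists2 d : R, 0 < d & forall t : R, `|t| < d -> F (y + t *: b) <= F y + eps.
Proof.
move=> Fc eps0.
(* By convexity F grows by at most |t| M from [y] towards [y + b] or [y - b]; the 1 keeps [M]
   positive. *)
pose M := 1 + `|F (y + b) - F y| + `|F (y - b) - F y|.
have M0 : 0 < M by rewrite /M -addrA ltr_wpDr ?addr_ge0.
exists (Num.min 1 (eps / M)); first by rewrite lt_min ltr01 divr_gt0.
move=> t; rewrite lt_min => /andP[t1 tM].
have {}tM : `|t| * M <= eps by rewrite -ler_pdivlMr // ltW.
have main v (s : R) :
    0 <= s -> s <= 1 -> F (y + v) - F y <= M -> s * M <= eps ->
    F (y + s *: v) <= F y + eps.
  move=> s0 s1 vM sM; have := Fc (y + v) y s s0 s1.
  have -> : s *: (y + v) + (1 - s) *: y = y + s *: v by clear - J; vec J.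
  have := ler_wpM2l s0 vM; lra.
have [t0|t0] := leP 0 t.
  move: t1 tM; rewrite ger0_norm // => t1 tM.
  apply: main => //; first exact: ltW.
  have := ler_norm (F (y + b) - F y); have := normr_ge0 (F (y - b) - F y).
  by rewrite /M; lra.
move: t1 tM; rewrite ltr0_norm // => t1 tM.
rewrite -[t *: b]opprK -scaleNr -scalerN; apply: main => //; [lra|lra|].
have := ler_norm (F (y - b) - F y); have := normr_ge0 (F (y + b) - F y).
by rewrite /M; lra.
Qed.

(** Induction along the frame: adding one coordinate term and the remaining sum to [y] gives the
    midpoint of the two points where each is added alone, doubled. *)
Lemma convex_usc (F : V -> R) y (eps : R) : convex_fun F -> 0 < eps ->
  exists2 d : R, 0 < d & forall r, N r < d -> F (y + r) <= F y + eps.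
Proof.
move=> Fc eps0; have [s sP] := frame_exists J.
suff [d d0 dP] : exists2 d : R, 0 < d &
    forall r, N r < d -> F (y + \sum_(b <- s) '[r, b] *: b) <= F y + eps.
  by exists d => // r /dP; rewrite -sP.
elim: s {sP} => [|b s [d1 d1_gt0 d1P]].
  by exists 1 => // r _; rewrite big_nil addr0 lerDl ltW.
have [d2 d2_gt0 d2P] := convex_line y b Fc eps0.
have Nb := jnorm_ge0 J b.
have b_gt0 : 0 < 2 * (N b + 1) by lra.
(* The factors 2 absorb the doubling, and [N b + 1] bounds the coordinate along [b] while avoiding
   division by 0. *)
exists (Num.min (d1 / 2) (d2 / (2 * (N b + 1)))).
  by rewrite lt_min !divr_gt0.
move=> r; rewrite lt_min => /andP[]; rewrite !ltr_pdivlMr // => r1 r2.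
rewrite big_cons.
set S := \sum_(b <- s) _.
have -> : y + ('[r, b] *: b + S) =
    2^-1 *: (y + (2 * '[r, b]) *: b) + (1 - 2^-1) *: (y + 2 *: S) by vec J.
apply: (le_trans (Fc _ _ _ _ _)); [lra|lra|].
have H2 : F (y + (2 * '[r, b]) *: b) <= F y + eps.
  apply: d2P; rewrite normrM ger0_norm //; apply: le_lt_trans r2.
  have := normr_jinner_le J r b; have := jnorm_ge0 J r; nra.
have H1 : F (y + 2 *: S) <= F y + eps.
  have -> : 2 *: S = \sum_(b <- s) '[2 *: r, b] *: b.
    by rewrite scaler_sumr; apply: eq_bigr => a _; rewrite jinnerZl scalerA.
  by apply: d1P; rewrite jnormZ ger0_norm // mulrC.
lra.
Qed.

Lemma small_parameter (C K d : R) : 0 < C -> 0 < K -> 0 < d ->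
  exists2 t : R, 0 < t & [/\ t <= 1, t <= K & C * t < d].
Proof.
move=> C_gt0 K_gt0 d0; exists (Num.min (Num.min 1 K) (d / (2 * C))).
  by rewrite !lt_min ltr01 K_gt0 divr_gt0 ?mulr_gt0.
split; rewrite ?ge_min ?lexx ?orbT //.
rewrite mulrC -ltr_pdivlMr // gt_min; apply/orP; right.
have CC : C < 2 * C by lra.
by rewrite ltr_pM2l // ltf_pV2 ?posrE ?mulr_gt0.
Qed.

(** The point z + t h + r divides the segment from z to z + h + r/t, so F z <= F (z + h + r/t); as
    r/t is O(t), upper semicontinuity concludes. *)
Lemma first_order_min (F : V -> R) z h (C K : R) :
    convex_fun F -> 0 < C -> 0 < K ->
    (forall t : R, 0 < t -> t <= K ->
       exists2 r, N r <= C * t ^+ 2 & F z <= F (z + t *: h + r)) ->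
  F z <= F (z + h).
Proof.
move=> Fc C_gt0 K_gt0 near; apply/ler_addgt0Pr => eps eps0.
have [d d0 dP] := convex_usc (z + h) Fc eps0.
have [t t0 [t1 tK tC]] := small_parameter C_gt0 K_gt0 d0.
have [r rC Fr] := near t t0 tK.
apply: le_trans (dP (t^-1 *: r) _); last first.
  apply: le_lt_trans tC; rewrite jnormZ gtr0_norm ?invr_gt0 //.
  by rewrite ler_pdivrMl // mulrC -mulrA -expr2.
rewrite -(ler_pM2l t0).
have := Fc (z + h + t^-1 *: r) z t (ltW t0) t1.
have -> : t *: (z + h + t^-1 *: r) + (1 - t) *: z = z + t *: h + r.
  rewrite !scalerDr scalerA divff ?gt_eqF // scale1r; clear - J; vec J.
lra.
Qed.

(* Here [z] is a convex combination of [z - t h + r] and [z + h - r / t]. *)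
Lemma first_order_max (F : V -> R) z h (C K : R) :
    convex_fun F -> 0 < C -> 0 < K ->
    (forall t : R, 0 < t -> t <= K ->
       exists2 r, N r <= C * t ^+ 2 & F (z - t *: h + r) <= F z) ->
  F z <= F (z + h).
Proof.
move=> Fc C_gt0 K_gt0 near; apply/ler_addgt0Pr => eps eps0.
have [d d0 dP] := convex_usc (z + h) Fc eps0.
have [t t0 [t1 tK tC]] := small_parameter C_gt0 K_gt0 d0.
have [r rC Fr] := near t t0 tK.
apply: le_trans (dP (- (t^-1 *: r)) _); last first.
  apply: le_lt_trans tC; rewrite jnormN jnormZ gtr0_norm ?invr_gt0 //.
  by rewrite ler_pdivrMl // mulrC -mulrA -expr2.
have T0 : 0 < 1 + t by lra.
have Tn : 1 + t != 0 by rewrite gt_eqF.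
(* With weights [k] and [k * t], the terms in [h] and [r] cancel. *)
pose k := (1 + t)^-1.
have kT : k * (1 + t) = 1 by rewrite mulVf.
have k_gt0 : 0 < k by rewrite invr_gt0.
have kt : 1 - k = k * t by lra.
have k1 : k <= 1 by nra.
have := Fc (z - t *: h + r) (z + h - t^-1 *: r) k (ltW k_gt0) k1.
have -> : k *: (z - t *: h + r) + (1 - k) *: (z + h - t^-1 *: r) = z.
  rewrite kt -scalerA -scalerDr -[RHS]scale1r -kT -scalerA; congr (_ *: _).
  rewrite !scalerDr scalerN scalerA divff ?gt_eqF // scale1r; clear - J; vec J.
rewrite kt => H; rewrite -(ler_pM2l (mulr_gt0 k_gt0 t0)).
have := ler_wpM2l (ltW k_gt0) Fr.
have : (1 - k) * F z = k * t * F z by rewrite kt.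
lra.
Qed.

End Convexity.

Section Automorphisms.
Variables (R : realType) (V : vectType R) (J : euclideanJordanAlgebra V).

Local Notation "x ** y" := (jmul J x y) (at level 40, left associativity).
Local Notation e := (junit J).

Lemma jaut_inv (X : 'End(V)) : jaut J X ->
  exists Y, [/\ jaut J Y, cancel X Y & cancel Y X].
Proof.
case=> -[g gK Kg] XM.
have kerX : lker X == 0%VS by apply/lker0P; exact: can_inj gK.
have invE v : (X^-1)%VF v = g v by rewrite -{1}(Kg v) lker0_lfunK.
have XK : cancel X (X^-1)%VF by move=> v; rewrite invE.
have KX : cancel (X^-1)%VF X by move=> v; rewrite invE.
exists (X^-1)%VF; split=> //; split; first by exists X.
by move=> a b; apply: (can_inj gK); rewrite XM !KX.
Qed.

Lemma jaut_unit X : jaut J X -> X e = e.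
Proof.
move=> autX; have [Y [_ _ YX]] := jaut_inv autX; have [_ XM] := autX.
by rewrite -[LHS](jmul1x J) -{1}(YX e) -XM jmulx1 YX.
Qed.

Lemma jaut_idempotent X c : jaut J X -> jidempotent J c -> jidempotent J (X c).
Proof. by case=> _ XM cc; rewrite /jidempotent -XM cc. Qed.

Lemma jaut_neq0 X c : jaut J X -> c != 0 -> X c != 0.
Proof.
move=> autX c0; have [Y [_ XY _]] := jaut_inv autX.
by apply: contraNneq c0 => Xc0; rewrite -(XY c) Xc0 linear0.
Qed.

Lemma jaut_primitive X c : jaut J X -> jprimitive J c -> jprimitive J (X c).
Proof.
move=> autX [cc c0 c_prim]; split; [exact: jaut_idempotent|exact: jaut_neq0|].
have [Y [autY XY _]] := jaut_inv autX.
move=> [c1 [c2 [cc1 cc2 c10 c20 cE]]]; apply: c_prim.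
exists (Y c1), (Y c2); split; try exact: jaut_idempotent; try exact: jaut_neq0.
by rewrite -[LHS]XY cE linearD.
Qed.

(** Automorphisms carry Jordan frames to Jordan frames, so [xget] chooses from the same set for
    [X x] and [x]. *)
Lemma jaut_eigenvalues X x : jaut J X -> eigenvalues J (X x) = eigenvalues J x.
Proof.
have transport Y y (l : 'cV[R]_(jrank J)) :
    jaut J Y -> is_eigenvalues y l -> is_eigenvalues (Y y) l.
  move=> autY [l_sorted [c [c_prim c_orth c_sum] yE]]; split=> //.
  exists (Y \o c).
    split=> [i|i j ij|] /=; first exact: jaut_primitive.
      by rewrite -(autY.2) c_orth // linear0.
    by rewrite -[RHS](jaut_unit autY) -c_sum linear_sum.
  by rewrite yE linear_sum; apply: eq_bigr => i _; rewrite linearZ.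
move=> autX; have [Y [autY XY _]] := jaut_inv autX.
rewrite /eigenvalues; congr (xget _ _); apply/seteqP; split=> l /=.
  by move=> /(transport Y _ _ autY); rewrite XY.
exact: transport.
Qed.

Lemma spectral_function_jaut F X x :
  spectral_function J F -> jaut J X -> F (X x) = F x.
Proof. by case=> f _ FE autX; rewrite !FE jaut_eigenvalues. Qed.

End Automorphisms.

(** * From a local extremum to an inequality in tangent directions *)

Section LocalExtremum.
Variables (R : realType) (V : vectType R) (J : euclideanJordanAlgebra V).

Local Notation "x ** y" := (jmul J x y) (at level 40, left associativity).
Local Notation N := (jnorm J).
Local Notation e := (junit J).

Lemma extremum_tangent (a xbar h : V) (E : set V) (F : V -> R) (C : R) :
    weakly_spectral J E -> convex_fun F ->
    local_minimizer J E (fun x => F (x - a)) xbar \/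
      local_maximizer J E (fun x => F (x - a)) xbar ->
    0 < C ->
    (forall t : R, `|t| <= 1 -> exists2 X, jaut J X &
       N (X xbar - xbar - t *: h) <= C * t ^+ 2) ->
  F (xbar - a) <= F (xbar - a + h).
Proof.
move=> Ews Fc extr C_gt0 curve; set z := xbar - a.
have nearby (r0 : R) : E xbar -> 0 < r0 -> exists2 K : R, 0 < K &
    forall t, `|t| <= K -> exists r, [/\ N r <= C * t ^+ 2,
      E (xbar + t *: h + r) & N (xbar + t *: h + r - xbar) < r0].
  move=> Ex r0_gt0.
  have Nh := jnorm_ge0 J h.
  (* As t^2 <= |t|, the displacement t h + r has norm at most (N h + C)|t|. *)
  have B_gt0 : 0 < N h + C by rewrite ltr_wpDl.
  have [K K_gt0 [K1 _ Kr]] := small_parameter B_gt0 ltr01 r0_gt0.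
  exists K => // t tK; have t1 := le_trans tK K1.
  have [X autX XP] := curve t t1.
  exists (X xbar - xbar - t *: h); split=> //.
    have -> : xbar + t *: h + (X xbar - xbar - t *: h) = X xbar.
      by clear - J; vec J.
    exact: Ews.
  have -> : xbar + t *: h + (X xbar - xbar - t *: h) - xbar =
      t *: h + (X xbar - xbar - t *: h) by clear - J; vec J.
  apply: le_lt_trans (jnormD _ _ _) _; apply: le_lt_trans Kr; rewrite jnormZ.
  have t2 : t ^+ 2 <= `|t| by rewrite -real_normK ?num_real // expr2 ler_piMl.
  have := ler_wpM2r Nh tK; have := ler_wpM2l (ltW C_gt0) (le_trans t2 tK); lra.
have zE v w : xbar + v + w - a = z + v + w.
  by rewrite /z -!addrA [w - a]addrC (addrCA v).
case: extr => -[Ex [r0 r0_gt0 xP]]; have [K K_gt0 KP] := nearby r0 Ex r0_gt0.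
  apply: (@first_order_min _ _ J F z h C K) => // t t0 tK.
  have [|r [rC Er Nr]] := KP t; first by rewrite gtr0_norm.
  by exists r => //; have := xP _ Er Nr; rewrite /= zE.
(* A maximum is tested backwards along the curve, at parameter -t. *)
apply: (@first_order_max _ _ J F z h C K) => // t t0 tK.
have [|r [rC Er Nr]] := KP (- t); first by rewrite normrN gtr0_norm.
rewrite sqrrN in rC; exists r => //; have := xP _ Er Nr.
by rewrite /= zE scaleNr.
Qed.

End LocalExtremum.

Theorem theorem5 (R : realType) (V : vectType R)
    (J : euclideanJordanAlgebra V) (a : V) (E : set V) (F : V -> R)
    (xbar : V) :
  weakly_spectral J E ->
  spectral_function J F ->
  strictly_convex_function F \/ strictly_convex_norm F ->
  local_minimizer J E (fun x => F (x - a)) xbar \/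
    local_maximizer J E (fun x => F (x - a)) xbar ->
  operator_commute J xbar a.
Proof.
move=> Ews Fs Fsc extr.
have [Fc Flev] : convex_fun F /\ strict_on_levels F.
  case: Fsc => [Fsc|Fsn].
    by split; [exact: strictly_convex_convex | exact: strictly_convex_levels].
  by split; [exact: norm_convex Fsn.1 | exact: strictly_convex_norm_levels].
have [s [c [s_uniq eE xc cc orth]]] := jordan_spectral J xbar.
set z := xbar - a.
have zP k : k \in s -> Pplus J (c k) z.
  move=> sk; have ck := cc k sk.
  (* Adding this vector to [z] leaves the even part of [z], the midpoint of [z] and its
     reflection. *)
  have vM : Pminus J (c k) (- pminus J (c k) z).
    by rewrite /Pminus jmulNr Pminus_pminus // scalerN.
  have [u uM vE] := eigenprojection_onto s_uniq eE xc cc orth sk vM.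
  have xP : Pplus J (c k) xbar.
    by rewrite /Pplus (jmulC J (c k) xbar) xc jmulZr ck.
  have [C C_gt0 curve] := orbit_curve ck xP uM.
  rewrite vE in curve.
  have := extremum_tangent Ews Fc extr C_gt0 curve; rewrite -/z => F_le.
  have zE : z - pminus J (c k) z = 2^-1 *: (z + refl J (c k) z).
    by rewrite /refl; clear - J; vec J.
  have Frefl : F z = F (refl J (c k) z).
    rewrite -quad_refl (spectral_function_jaut _ Fs) //; apply: quad_jaut.
    by rewrite !jmulE !jmulx1 !jmul1x ck; clear - J; vec J.
  have [zr|zr] := eqVneq z (refl J (c k) z); last first.
    by have := Flev _ _ Frefl zr; rewrite -zE ltNge F_le.
  have -> : z = z - pminus J (c k) z.
    by rewrite zE -zr; clear - J; vec J.
  exact: Pplus_pplus.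
have xE : xbar = \sum_(k <- s) k *: c k.
  by rewrite -{1}[xbar](jmulx1 J) -eE jmul_sumr; apply: eq_bigr.
have xz v : jmul J xbar (jmul J z v) = jmul J z (jmul J xbar v).
  rewrite xE !jmul_suml jmul_sumr; apply: eq_big_seq => k sk.
  by rewrite !jmulZl jmulZr (Pplus_comm (cc k sk) v (zP k sk)).
(* L_z is the difference of L_xbar and L_a, so commuting with L_xbar passes from L_z to L_a. *)
apply/lfunP => v; rewrite !comp_lfunE !lfunE /=.
have := xz v; rewrite /z !jmulE; clear - J => H.
vec J.
Qed.
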